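(* The function $$x\mapsto \frac{\ln\Gamma(x+1)}{\ln(x^2+1)-\ln(x+1)}$$ is strictly increasing on $(0,1)$, with the limits $$\lim_{x\to0^+}\frac{\ln\Gamma(x+1)}{\ln(x^2+1)-\ln(x+1)}=\gamma \quad\text{and}\quad \lim_{x\to1^-}\frac{\ln\Gamma(x+1)}{\ln(x^2+1)-\ln(x+1)}=2(1-\gamma).$$ As a result, for real numbers $\alpha,\beta$, the double inequality $$\biggl(\frac{x^2+1}{x+1}\biggr)^\alpha<\Gamma(x+1)<\biggl(\frac{x^2+1}{x+1}\biggr)^\beta$$ holds for all $x\in(0,1)$ if and only if $\alpha\ge2(1-\gamma)$ and $\beta\le\gamma$. Consequently, for real numbers $\alpha,\beta$, the double inequality $$\biggl[\frac{(x-\lfloor x\rfloor)^2+1}{x-\lfloor x\rfloor+1}\biggr]^\alpha\prod_{i=0}^{\lfloor x\rfloor-1}(x-i)<\Gamma(x+1)<\biggl[\frac{(x-\lfloor x\rfloor)^2+1}{x-\lfloor x\rfloor+1}\biggr]^\beta\prod_{i=0}^{\lfloor x\rfloor-1}(x-i)$$ holds for all $x\in(0,\infty)\setminus\mathbb{N}$ if and only if $\alpha\ge2(1-\gamma)$ and $\beta\le\gamma$.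
   Context: $\Gamma$ is Euler's gamma function, $\Gamma(x)=\int_0^\infty t^{x-1}e^{-t}\,dt$ for $x>0$; $\gamma=0.57\ldots$ is the Euler--Mascheroni constant; $\lfloor x\rfloor$ is the largest integer less than or equal to $x$; $\mathbb{N}$ is the set of positive integers; an empty product (the case $\lfloor x\rfloor=0$) equals $1$. *)

(* Defs.v *)
From Stdlib Require Export Reals List.
From Coquelicot Require Export Coquelicot.
Open Scope R_scope.

(* Meaningful for [0 < x], where the integral, improper at both ends,
   converges; [Rpower] is only evaluated at [t > 0]. *)
Definition Gamma (x : R) : R :=
  RInt_gen (fun t => Rpower t (x - 1) * exp (- t))
    (at_right 0) (Rbar_locally p_infty).

(* The index is shifted by one: the [n]-th term is
   1 + 1/2 + ... + 1/(n+1) - ln (n+1). *)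
Definition euler_gamma : R :=
  real (Lim_seq (fun n => sum_f_R0 (fun k => / INR (S k)) n - ln (INR (S n)))).

(* [Int_part x], i.e. [up x - 1], is the floor of [x] (see [base_Int_part]).
   For [0 <= x] this is the product of [x - i] over the integers
   [0 <= i <= Int_part x - 1], with value 1 when [Int_part x = 0]. *)
Definition floor_prod (x : R) : R :=
  fold_right Rmult 1
    (map (fun i => x - INR i) (seq 0 (Z.to_nat (Int_part x)))).

Definition gamma_ratio (x : R) : R :=
  ln (Gamma (x + 1)) / (ln (x ^ 2 + 1) - ln (x + 1)).

(* Main.v *)
Require Import Defs.
From Stdlib Require Import Reals List Factorial ZArith Lra Lia.
From Coquelicot Require Import Coquelicot.
Open Scope R_scope.

(** Write [f x = - ln (Gamma (1 + x))] and [G x = ln (1 + x) - ln (1 + x ^ 2)], both positive on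
    [(0, 1)], so that the ratio is [f / G].

    Euler's product gives [f x] as the sum over [n >= 1] of
    [gap x n = ln (1 + x / n) - x * ln (1 + 1 / n)] ([is_lim_gap_sum]).  It follows from the
    functional equation of Gamma and from Wendel's bounds, which express that [t ^ x] lies below
    its tangents.  Moreover [gap x t] is [x * (1 - x)] times the integral of
    [/ (s * (s + 1) * (s + x))] over [s >= t] ([is_tail_gap]).

    Limits.  Replacing [s + x] by [s] or by [s + 1] shows that [f x / (x * (1 - x))] lies between
    [(1 - x) * gamma] and [gamma], and between [1 - gamma] and [(2 - x) * (1 - gamma)], because the
    sums of the integrals of [/ (s ^ 2 * (s + 1))] and [/ (s * (s + 1) ^ 2)] over [s >= n] are
    [gamma] and [1 - gamma].  It remains to find the limits of [x * (1 - x) / G x], which are 1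
    and 2.

    Monotonicity.  The ratio factors as the product of [(2 + x) * f x / (x * (1 - x))] and
    [x * (1 - x) / ((2 + x) * G x)].  In the first factor ([weighted_ln_Gamma_incr]) only the part
    [s < 2] of the integrals decreases with [x], and the loss is compensated by the other terms of
    the series: the single crossing at [s = 2] bounds every increment below by a positive multiple
    of [kappa n] ([weighted_gap_increment]), and the partial sums of [kappa] are nonnegative from
    the seventh on ([sum_kappa_nonneg]).  The second factor is elementary and strictly increasing
    ([shape_incr]), by an argument of the type of l'Hopital's monotone rule on each side of the
    critical point of [x * (1 - x) / (2 + x)].  With [c + x] in place of [2 + x], the
    second factor would increase near 0 only for [c >= 2], while a larger [c] makes more of the
    integrals in the first one decrease.

    The double inequality on [(0, 1)] says that the ratio lies between [beta] and [alpha], so it is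
    equivalent to the bounds given by the two limits.  The one on the half-line reduces to it,
    since by the functional equation Gamma at [x + 1] is the floor product times Gamma at the
    fractional part plus 1. *)

(** * Monotone functions and improper integrals on the half-line *)

Lemma derive_nonneg_le (F dF : R -> R) (x y : R) :
  x <= y ->
  (forall t, x <= t <= y -> is_derive F t (dF t)) ->
  (forall t, x <= t <= y -> 0 <= dF t) ->
  F x <= F y.
Proof.
  intros Hxy HF Hd.
  destruct (MVT_gen F x y dF) as [c [Hc Heq]].
  - intros t. rewrite Rmin_left, Rmax_right by assumption.
    intros Ht. apply HF. lra.
  - intros t. rewrite Rmin_left, Rmax_right by assumption.
    intros Ht. apply continuity_pt_filterlim.
    apply (ex_derive_continuous F). exists (dF t). now apply HF.
  - rewrite Rmin_left, Rmax_right in Hc by assumption.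
    assert (0 <= dF c * (y - x)) by (apply Rmult_le_pos; [now apply Hd | lra]).
    lra.
Qed.

(** The second fundamental theorem of calculus, improper at both ends: the integral is the
    difference of the limits of a primitive. *)
Lemma is_RInt_gen_halfline (F p : R -> R) (la lb : R) :
  (forall t, 0 < t -> is_derive F t (p t)) ->
  (forall t, 0 < t -> continuous p t) ->
  filterlim F (at_right 0) (locally la) ->
  filterlim F (Rbar_locally p_infty) (locally lb) ->
  is_RInt_gen p (at_right 0) (Rbar_locally p_infty) (lb - la).
Proof.
  intros HF Hp Ha Hb.
  assert (Hpos : forall P : R -> Prop, (forall t, 0 < t -> P t) ->
    filter_prod (at_right 0) (Rbar_locally p_infty) (fun ab : R * R =>
      forall x, Rmin (fst ab) (snd ab) <= x <= Rmax (fst ab) (snd ab) -> P x)).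
  { intros P HP.
    apply Filter_prod with (Q := fun a => 0 < a) (R := fun b => 0 < b).
    - exists (mkposreal 1 Rlt_0_1). intros y _ Hy. exact Hy.
    - exists 0. intros y Hy. exact Hy.
    - intros a b Ha' Hb' x [Hx _]. apply HP. simpl in Hx.
      apply Rlt_le_trans with (2 := Hx). now apply Rmin_glb_lt. }
  apply is_RInt_gen_ext with (f := Derive F).
  - generalize (Hpos (fun x => Derive F x = p x)
      (fun t Ht => is_derive_unique _ _ _ (HF t Ht))).
    apply filter_imp. intros ab H x Hx. apply H. lra.
  - apply is_RInt_gen_Derive; try assumption.
    + apply Hpos. intros t Ht. exists (p t). now apply HF.
    + apply Hpos. intros t Ht.
      apply continuous_ext_loc with (g := p).
      * exists (mkposreal t Ht). intros y Hy.
        symmetry. apply is_derive_unique, HF.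
        apply Rabs_lt_between' in Hy. simpl in Hy. lra.
      * now apply Hp.
Qed.

Lemma mono_bounded_cv (F : R -> R) (M : R) :
  (forall x y, 0 < x -> x <= y -> F x <= F y) ->
  (forall x, 0 < x -> F x <= M) ->
  exists l, filterlim F (Rbar_locally p_infty) (locally l).
Proof.
  intros Hm Hb.
  destruct (completeness (fun v => exists x, 0 < x /\ v = F x)) as [l [Hu Hl]].
  - exists M. intros v [x [Hx ->]]. now apply Hb.
  - exists (F 1). exists 1. split; [lra | easy].
  - exists l. apply filterlim_locally. intros eps.
    destruct (Classical_Prop.classic (exists x, 0 < x /\ l - eps < F x)) as [[x0 [Hx0 H0]]|Hn].
    + exists x0. intros y Hy. apply Rabs_lt_between'.
      split.
      * apply Rlt_le_trans with (1 := H0). apply Hm; lra.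
      * apply Rle_lt_trans with l; [| destruct eps; simpl; lra].
        apply Hu. exists y. split; [lra | easy].
    + exfalso. assert (l <= l - eps); [|destruct eps; simpl in *; lra].
      apply Hl. intros v [x [Hx ->]].
      destruct (Rle_dec (F x) (l - eps)) as [h|h]; [easy|].
      exfalso. apply Hn. exists x. split; lra.
Qed.

(** The primitive of [p] that vanishes at 1 increases, and grows at most as much as the bounded
    [Q]; hence it has finite limits at both ends.  The limit at 0 is the one at infinity after
    the substitution [t = / u]. *)
Lemma ex_RInt_gen_dominated (p q Q : R -> R) (M : R) :
  (forall t, 0 < t -> continuous p t) ->
  (forall t, 0 < t -> 0 <= p t <= q t) ->
  (forall t, 0 < t -> is_derive Q t (q t)) ->
  (forall t, 0 < t -> Rabs (Q t) <= M) ->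
  ex_RInt_gen p (at_right 0) (Rbar_locally p_infty).
Proof.
  intros Hc Hpq HQ HM.
  set (F := fun t => RInt p 1 t).
  assert (HF : forall t, 0 < t -> is_derive F t (p t)).
  { intros t Ht. apply (is_derive_RInt p F 1 t).
    - exists (mkposreal t Ht). intros y Hy.
      apply Rabs_lt_between' in Hy. simpl in Hy.
      apply (RInt_correct p), (ex_RInt_continuous p).
      intros z [Hz _]. apply Hc.
      apply Rlt_le_trans with (2 := Hz). apply Rmin_glb_lt; lra.
    - now apply Hc. }
  assert (HF1 : forall u t, 0 < u -> u <= t -> F u <= F t).
  { intros u t Hu Hut. apply derive_nonneg_le with p; try assumption.
    - intros v Hv. apply HF. lra.
    - intros v Hv. apply Hpq. lra. }
  assert (HF2 : forall u t, 0 < u -> u <= t -> F t - F u <= 2 * M).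
  { intros u t Hu Hut.
    assert (H : Q u - F u <= Q t - F t).
    { apply (derive_nonneg_le (fun v => Q v - F v) (fun v => q v - p v)); try assumption.
      - intros v Hv. apply (is_derive_minus Q F); [apply HQ | apply HF]; lra.
      - intros v Hv. assert (0 < v) by lra. specialize (Hpq v). lra. }
    assert (Hu' := HM u Hu). assert (Ht' : Rabs (Q t) <= M) by (apply HM; lra).
    apply Rabs_le_between in Hu'. apply Rabs_le_between in Ht'. lra. }
  assert (HFb : forall t, 0 < t -> - (2 * M) <= F t <= 2 * M).
  { intros t Ht.
    assert (H1 : F 1 = 0) by exact (RInt_point 1 p).
    assert (0 <= 2 * M) by (specialize (HF2 1 1); lra).
    destruct (Rle_dec 1 t) as [h|h].
    - generalize (HF2 1 t) (HF1 1 t). lra.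
    - generalize (HF2 t 1) (HF1 t 1). lra. }
  destruct (mono_bounded_cv F (2 * M)) as [lb Hlb]; [assumption | intros; now apply HFb |].
  destruct (mono_bounded_cv (fun u => - F (/ u)) (2 * M)) as [la Hla].
  - intros x y Hx Hxy. apply Ropp_le_contravar, HF1.
    + apply Rinv_0_lt_compat. lra.
    + now apply Rinv_le_contravar.
  - intros x Hx. generalize (HFb (/ x) (Rinv_0_lt_compat _ Hx)). lra.
  - exists (lb - - la).
    apply is_RInt_gen_halfline with F; try assumption.
    apply filterlim_ext with (f := fun t => - - F (/ / t)).
    + intros t. now rewrite Ropp_involutive, Rinv_inv.
    + apply (filterlim_comp _ _ _ (fun t => - F (/ / t)) Ropp _ (locally la)).
      * apply (filterlim_comp _ _ _ Rinv (fun u => - F (/ u)) _ (Rbar_locally p_infty)).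
        -- apply filterlim_Rinv_0_right.
        -- assumption.
      * apply (filterlim_opp la).
Qed.

Lemma is_RInt_gen_halfline_le (p q : R -> R) (lp lq : R) :
  (forall t, 0 < t -> 0 <= p t <= q t) ->
  is_RInt_gen p (at_right 0) (Rbar_locally p_infty) lp ->
  is_RInt_gen q (at_right 0) (Rbar_locally p_infty) lq ->
  lp <= lq.
Proof.
  intros H Hp Hq. apply Rle_trans with (1 := Rle_abs lp).
  apply (RInt_gen_norm (Fa := at_right 0) (Fb := Rbar_locally p_infty) p q lp lq); try assumption.
  - apply Filter_prod with (Q := fun a => a < 1) (R := fun b => 1 < b).
    + exists (mkposreal 1 Rlt_0_1). intros y Hy _. apply Rabs_lt_between' in Hy. simpl in Hy. lra.
    + exists 1. easy.
    + simpl. intros; lra.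
  - apply Filter_prod with (Q := fun a => 0 < a) (R := fun b => True).
    + exists (mkposreal 1 Rlt_0_1). easy.
    + exists 1. easy.
    + simpl. intros a b Ha _ t Ht. assert (0 < t) by lra.
      unfold norm; simpl; unfold abs; simpl. rewrite Rabs_pos_eq; now apply H.
Qed.

Lemma continuous_at_right (f : R -> R) (a : R) :
  continuous f a -> filterlim f (at_right a) (locally (f a)).
Proof.
  intros H. eapply filterlim_filter_le_1; [apply filter_le_within | exact H].
Qed.

Lemma ln_le_sub_1 t : 0 < t -> ln t <= t - 1.
Proof.
  intros Ht. generalize (exp_ineq1_le (ln t)). rewrite exp_ln by assumption. lra.
Qed.

Lemma exp_le x y : x <= y -> exp x <= exp y.
Proof.
  intros [H | ->]; [apply Rlt_le, exp_increasing; easy | apply Rle_refl].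
Qed.

(** * The Gamma function on [[1, +oo)] *)

Definition gamma_integrand (s t : R) := Rpower t (s - 1) * exp (- t).

Lemma gamma_integrand_continuous s t : 0 < t -> continuous (gamma_integrand s) t.
Proof.
  intros Ht. apply (ex_derive_continuous (gamma_integrand s)). unfold gamma_integrand, Rpower.
  auto_derive. easy.
Qed.

Lemma gamma_integrand_pos s t : 0 < gamma_integrand s t.
Proof. apply Rmult_lt_0_compat; apply exp_pos. Qed.

(** The bound comes from [ln u <= u - 1] at [u = t / (2 s)].  Asking for [1 <= s] makes a single
    exponential dominate the integrand on the whole half-line, with no singularity at 0; only
    such [s] occur below, since Gamma is always taken at [x + 1]. *)
Lemma gamma_integrand_bound s t : 1 <= s -> 0 < t ->
  gamma_integrand s t <= Rpower (2 * s) (s - 1) * exp (- t / 2).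
Proof.
  intros Hs Ht. unfold gamma_integrand, Rpower.
  rewrite <- !exp_plus. apply exp_le.
  assert (H : ln (t / (2 * s)) <= t / (2 * s) - 1).
  { apply ln_le_sub_1. apply Rdiv_lt_0_compat; lra. }
  rewrite ln_div in H by lra.
  assert (H' : (s - 1) * (ln t - ln (2 * s)) <= (s - 1) * (t / (2 * s))).
  { apply Rmult_le_compat_l; lra. }
  assert (E : (s - 1) * (t / (2 * s)) = t / 2 - t / (2 * s)) by (field; lra).
  assert (0 < t / (2 * s)) by (apply Rdiv_lt_0_compat; lra).
  lra.
Qed.

Lemma Gamma_correct s : 1 <= s ->
  is_RInt_gen (gamma_integrand s) (at_right 0) (Rbar_locally p_infty) (Gamma s).
Proof.
  intros Hs. set (C := Rpower (2 * s) (s - 1)).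
  assert (HC : 0 < C) by apply exp_pos.
  apply (RInt_gen_correct (gamma_integrand s)).
  apply ex_RInt_gen_dominated with (q := fun t => C * exp (- t / 2))
    (Q := fun t => - 2 * C * exp (- t / 2)) (M := 2 * C).
  - apply gamma_integrand_continuous.
  - intros t Ht. split.
    + apply Rlt_le, gamma_integrand_pos.
    + now apply gamma_integrand_bound.
  - intros t Ht. auto_derive; [easy | unfold Rdiv; field].
  - intros t Ht. rewrite Rabs_left1.
    + assert (exp (- t / 2) <= 1) by (rewrite <- exp_0; apply exp_le; lra).
      assert (C * exp (- t / 2) <= C * 1) by (apply Rmult_le_compat_l; lra). lra.
    + generalize (Rmult_lt_0_compat _ _ HC (exp_pos (- t / 2))). lra.
Qed.

Lemma Gamma_unique s l :
  is_RInt_gen (gamma_integrand s) (at_right 0) (Rbar_locally p_infty) l -> Gamma s = l.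
Proof. exact (is_RInt_gen_unique (gamma_integrand s) l). Qed.

Lemma Gamma_1 : Gamma 1 = 1.
Proof.
  apply Gamma_unique. replace 1 with (0 - - 1) at 2 by ring.
  apply is_RInt_gen_halfline with (fun t => - exp (- t)).
  - intros t Ht. unfold gamma_integrand. rewrite Rminus_diag, Rpower_O by assumption.
    auto_derive; [easy | ring].
  - apply gamma_integrand_continuous.
  - replace (-1) with (- exp (- 0)) by (rewrite Ropp_0, exp_0; ring).
    apply (continuous_at_right (fun t => - exp (- t))).
    apply (ex_derive_continuous (fun t => - exp (- t))). auto_derive. easy.
  - apply (is_lim_ext (fun t => - exp (-1 * t + 0)) _ p_infty 0).
    { intros t. do 2 f_equal. ring. }
    replace (Finite 0) with (Rbar_opp (Finite 0)) by (simpl; now rewrite Ropp_0).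
    apply is_lim_opp. apply is_lim_comp_lin; [|lra].
    replace (Rbar_plus (Rbar_mult (-1) p_infty) 0) with m_infty.
    + apply is_lim_exp_m.
    + simpl. destruct (Rle_dec 0 (-1)); [exfalso; lra | easy].
Qed.

Lemma gamma_boundary_term_bound s t : 1 <= s -> 0 < t ->
  0 <= Rpower t s * exp (- t) <= 2 * Rpower (2 * s) (s - 1) * (t / 2 * exp (- t / 2)).
Proof.
  intros Hs Ht. split.
  - apply Rlt_le, Rmult_lt_0_compat; apply exp_pos.
  - replace s with (s - 1 + 1) at 1 by ring.
    rewrite Rpower_plus, Rpower_1 by assumption.
    generalize (Rmult_le_compat_l t _ _ (Rlt_le _ _ Ht) (gamma_integrand_bound s t Hs Ht)).
    unfold gamma_integrand. lra.
Qed.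

(** Integration by parts: [- t ^ s * exp (- t)] is a primitive of the difference of the two
    integrands, and it vanishes at both ends. *)
Lemma Gamma_succ s : 1 <= s -> Gamma (s + 1) = s * Gamma s.
Proof.
  intros Hs.
  set (C := Rpower (2 * s) (s - 1)).
  assert (Hsplit : is_RInt_gen (fun t => gamma_integrand (s + 1) t - s * gamma_integrand s t)
    (at_right 0) (Rbar_locally p_infty) (0 - 0)).
  { apply is_RInt_gen_halfline with (fun t => - (Rpower t s * exp (- t))).
    - intros t Ht. unfold gamma_integrand.
      replace (s + 1 - 1) with s by ring.
      assert (E : Rpower t s = Rpower t (s - 1) * t).
      { rewrite <- (Rpower_1 t) at 3 by assumption. rewrite <- Rpower_plus. f_equal. ring. }
      unfold Rpower at 1. auto_derive; [easy |].
      change (exp (s * ln t)) with (Rpower t s). rewrite E. field. lra.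
    - intros t Ht.
      apply (continuous_minus (gamma_integrand (s + 1)) (fun t => s * gamma_integrand s t)).
      + now apply gamma_integrand_continuous.
      + apply (continuous_scal_r s (gamma_integrand s)).
        now apply gamma_integrand_continuous.
    - replace 0 with (- 0) at 2 by ring.
      apply (filterlim_comp _ _ _ (fun t => Rpower t s * exp (- t)) Ropp _ (locally 0));
        [| apply (filterlim_opp 0)].
      apply (filterlim_le_le (fun _ => 0) _ (fun t => 2 * C * (t / 2 * exp (- t / 2))) 0).
      + exists (mkposreal 1 Rlt_0_1). intros t _ Ht. now apply gamma_boundary_term_bound.
      + apply filterlim_const.
      + assert (H : filterlim (fun t => 2 * C * (t / 2 * exp (- t / 2))) (at_right 0)
          (locally (2 * C * (0 / 2 * exp (- 0 / 2))))).
        { apply (continuous_at_right (fun t => 2 * C * (t / 2 * exp (- t / 2)))).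
          apply (ex_derive_continuous (fun t => 2 * C * (t / 2 * exp (- t / 2)))).
          auto_derive. easy. }
        replace (2 * C * (0 / 2 * exp (- 0 / 2))) with 0 in H by field. exact H.
    - replace 0 with (- 0) by ring.
      apply (filterlim_comp _ _ _ (fun t => Rpower t s * exp (- t)) Ropp _ (locally 0));
        [| apply (filterlim_opp 0)].
      apply (filterlim_le_le (fun _ => 0) _ (fun t => 2 * C * (t / 2 * exp (- t / 2))) 0).
      + exists 0. intros t Ht. now apply gamma_boundary_term_bound.
      + apply filterlim_const.
      + apply (is_lim_ext (fun t => (- 2 * C) * ((- / 2 * t + 0) * exp (- / 2 * t + 0))) _ p_infty 0).
        { intros t. replace (- / 2 * t + 0) with (- t / 2) by field. field. }
        replace (Finite 0) with (Rbar_mult (- 2 * C) 0) by (simpl; f_equal; ring).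
        apply is_lim_scal_l.
        apply (is_lim_comp_lin (fun t => t * exp t)); [|lra].
        replace (Rbar_plus (Rbar_mult (- / 2) p_infty) 0) with m_infty.
        * apply is_lim_mul_exp_m.
        * simpl. destruct (Rle_dec 0 (- / 2)); [exfalso; lra | easy]. }
  apply Gamma_unique.
  replace (s * Gamma s) with (plus (0 - 0) (scal s (Gamma s)))
    by (unfold plus, scal; simpl; unfold mult; simpl; ring).
  apply is_RInt_gen_ext with (f := fun t => plus
    (gamma_integrand (s + 1) t - s * gamma_integrand s t) (scal s (gamma_integrand s t))).
  - apply filter_forall. intros ab t _.
    unfold plus, scal; simpl; unfold mult; simpl. ring.
  - apply (is_RInt_gen_plus (fun t => gamma_integrand (s + 1) t - s * gamma_integrand s t)
      (fun t => scal s (gamma_integrand s t))); [exact Hsplit |].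
    apply (is_RInt_gen_scal (gamma_integrand s)), Gamma_correct, Hs.
Qed.

(** The concave function [t ^ x] lies below its tangent at [a]. *)
Lemma rpower_tangent a t x : 0 < a -> 0 < t -> 0 < x < 1 ->
  Rpower t x <= Rpower a x * ((1 - x) + x * (t / a)).
Proof.
  intros Ha Ht Hx.
  assert (Hta : 0 < t / a) by now apply Rdiv_lt_0_compat.
  replace (Rpower t x) with (Rpower a x * Rpower (t / a) x).
  2: { rewrite Rpower_mult_distr by assumption. f_equal. field. lra. }
  apply Rmult_le_compat_l; [apply Rlt_le, exp_pos |].
  set (L := ln (t / a)).
  rewrite <- (exp_ln (t / a)) at 2 by assumption. unfold Rpower. fold L.
  set (v := exp (x * L)).
  assert (Hv : 0 < v) by apply exp_pos.
  (* The tangent to exp at [x * L] lies below exp at 0 and at [L]; the average of these two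
     bounds with weights [1 - x] and [x] is the claim. *)
  assert (H0 : v * (1 - x * L) <= 1).
  { replace 1 with (v * exp (- (x * L))) at 2.
    2: { unfold v. rewrite <- exp_plus, Rplus_opp_r. apply exp_0. }
    apply Rmult_le_compat_l; [now apply Rlt_le |].
    generalize (exp_ineq1_le (- (x * L))). lra. }
  assert (H1 : v * (1 + L - x * L) <= exp L).
  { replace (exp L) with (v * exp (L - x * L)).
    2: { unfold v. rewrite <- exp_plus. f_equal. ring. }
    apply Rmult_le_compat_l; [now apply Rlt_le |].
    generalize (exp_ineq1_le (L - x * L)). lra. }
  assert (K0 : (1 - x) * (v * (1 - x * L)) <= (1 - x) * 1) by (apply Rmult_le_compat_l; lra).
  assert (K1 : x * (v * (1 + L - x * L)) <= x * exp L) by (apply Rmult_le_compat_l; lra).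
  lra.
Qed.

(** Integrating the tangent bound for [t ^ x] against the integrand of [Gamma s].  With a good
    choice of [a] this gives the two bounds of Wendel for [Gamma (s + x) / Gamma s], which is all
    of the log-convexity of Gamma that Euler's product needs. *)
Lemma Gamma_shift_le s x a : 1 <= s -> 0 < x < 1 -> 0 < a ->
  Gamma (s + x) <= Rpower a x * ((1 - x) * Gamma s + x / a * Gamma (s + 1)).
Proof.
  intros Hs Hx Ha.
  apply (is_RInt_gen_halfline_le (gamma_integrand (s + x))
    (fun t => Rpower a x * ((1 - x) * gamma_integrand s t + x / a * gamma_integrand (s + 1) t))).
  - intros t Ht. split; [apply Rlt_le, gamma_integrand_pos |].
    unfold gamma_integrand.
    replace (s + x - 1) with (s - 1 + x) by ring.
    replace (s + 1 - 1) with (s - 1 + 1) by ring.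
    rewrite !Rpower_plus, Rpower_1 by assumption.
    generalize (Rmult_le_compat_l _ _ _ (Rlt_le _ _ (gamma_integrand_pos s t))
      (rpower_tangent a t x Ha Ht Hx)).
    unfold gamma_integrand, Rdiv. lra.
  - apply Gamma_correct. lra.
  - apply (is_RInt_gen_scal (fun t => (1 - x) * gamma_integrand s t
      + x / a * gamma_integrand (s + 1) t) (Rpower a x)).
    apply (is_RInt_gen_plus (fun t => (1 - x) * gamma_integrand s t)
      (fun t => x / a * gamma_integrand (s + 1) t)).
    + apply (is_RInt_gen_scal (gamma_integrand s)), Gamma_correct, Hs.
    + apply (is_RInt_gen_scal (gamma_integrand (s + 1))), Gamma_correct. lra.
Qed.

Lemma Gamma_shift_upper s x : 1 <= s -> 0 < x < 1 ->
  Gamma (s + x) <= Rpower s x * Gamma s.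
Proof.
  intros Hs Hx.
  apply Rle_trans with (1 := Gamma_shift_le s x s Hs Hx ltac:(lra)).
  rewrite Gamma_succ by assumption. apply Req_le. field. lra.
Qed.

(** The upper bound at [s + x] with the complementary shift [1 - x]. *)
Lemma Gamma_shift_lower s x : 1 <= s -> 0 < x < 1 ->
  s * Gamma s <= Rpower (s + x) (1 - x) * Gamma (s + x).
Proof.
  intros Hs Hx. rewrite <- Gamma_succ by assumption.
  replace (s + 1) with (s + x + (1 - x)) by ring.
  apply Gamma_shift_upper; lra.
Qed.

Lemma Gamma_INR n : Gamma (INR n + 1) = INR (fact n).
Proof.
  induction n as [|n IH].
  - simpl. rewrite Rplus_0_l. exact Gamma_1.
  - assert (H := pos_INR n). rewrite Gamma_succ by (rewrite S_INR; lra).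
    rewrite fact_simpl, mult_INR, <- IH. now rewrite S_INR at 2.
Qed.

Lemma Gamma_1_2_pos x : 0 < x < 1 -> 0 < Gamma (1 + x).
Proof.
  intros Hx.
  assert (H := Gamma_shift_lower 1 x (Rle_refl 1) Hx). rewrite Gamma_1 in H.
  apply Rmult_lt_reg_l with (Rpower (1 + x) (1 - x)); [apply exp_pos | lra].
Qed.

(** * Euler's product *)

(** By concavity of ln, [gap x t >= 0] for [x] in [[0, 1]]; it vanishes at both ends of this
    interval.  Euler's product says that [- ln (Gamma (1 + x))] is the sum of [gap x n] over
    the integers [n >= 1]. *)
Definition gap (x t : R) := ln (1 + x / t) - x * ln (1 + 1 / t).

(** The sum runs over the integers from 1 to [n + 1]. *)
Definition gap_sum (x : R) (n : nat) := sum_f_R0 (fun k => gap x (INR (S k))) n.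

Lemma ln_Gamma_shift x n : 0 < x < 1 ->
  0 < Gamma (INR (S (S n)) + x) /\
  ln (Gamma (INR (S (S n)) + x)) =
  ln (Gamma (1 + x)) + gap_sum x n + ln (INR (fact (S n))) + x * ln (INR (S (S n))).
Proof.
  intros Hx. assert (Hg := Gamma_1_2_pos x Hx).
  unfold gap_sum.
  induction n as [|n [IHp IHn]].
  - simpl sum_f_R0. change (INR 1) with 1. change (INR (fact 1)) with 1.
    replace (INR 2 + x) with (1 + x + 1) by (simpl; ring).
    rewrite Gamma_succ by lra. split; [apply Rmult_lt_0_compat; lra |].
    rewrite ln_mult by lra. unfold gap. rewrite ln_1.
    replace (1 + x / 1) with (1 + x) by field.
    replace (1 + 1 / 1) with (INR 2) by (simpl; field). ring.
  - assert (Hn := pos_INR n).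
    assert (Hf : 0 < INR (fact (S n))) by apply INR_fact_lt_0.
    rewrite tech5, fact_simpl, mult_INR.
    set (m := S (S n)) in *.
    assert (Hm : 1 < INR m) by (unfold m; rewrite !S_INR; lra).
    replace (INR (S m) + x) with (INR m + x + 1) by (rewrite (S_INR m); ring).
    rewrite Gamma_succ by lra. split; [apply Rmult_lt_0_compat; lra |].
    rewrite !ln_mult by lra. rewrite IHn.
    replace (gap x (INR m)) with (ln (1 + x / INR m) - x * ln (1 + 1 / INR m)) by easy.
    replace (1 + x / INR m) with ((INR m + x) / INR m) by (field; lra).
    replace (1 + 1 / INR m) with (INR (S m) / INR m) by (rewrite S_INR; field; lra).
    rewrite !ln_div by (rewrite ?S_INR; lra). ring.
Qed.

(** The functional equation expresses the partial sum by [Gamma (s + x)] and [Gamma s] at the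
    integer [s = n + 2], and the shift bounds give [Gamma (s + x) / (s ^ x * Gamma s)] up to a
    factor [(1 + x / s) ^ (1 - x)]. *)
Lemma gap_sum_bounds x n : 0 < x < 1 ->
  - ln (Gamma (1 + x)) - / INR (S (S n)) <= gap_sum x n <= - ln (Gamma (1 + x)).
Proof.
  intros Hx. destruct (ln_Gamma_shift x n Hx) as [Hp He].
  assert (Hf : Gamma (INR (S (S n))) = INR (fact (S n))).
  { rewrite <- Gamma_INR. reflexivity. }
  assert (Hf0 : 0 < INR (fact (S n))) by apply INR_fact_lt_0.
  set (s := INR (S (S n))) in *.
  assert (Hs : 1 <= s) by (unfold s; rewrite !S_INR; generalize (pos_INR n); lra).
  assert (HU := Gamma_shift_upper s x Hs Hx).
  assert (HL := Gamma_shift_lower s x Hs Hx).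
  apply ln_le in HU; [| assumption].
  rewrite Hf in *.
  apply ln_le in HL; [| apply Rmult_lt_0_compat; lra].
  rewrite !ln_mult in * by first [apply exp_pos | lra].
  unfold Rpower in *. rewrite !ln_exp in *.
  split; [| lra].
  assert (H : ln (s + x) - ln s <= x / s).
  { rewrite <- ln_div by lra.
    apply Rle_trans with (1 := ln_le_sub_1 ((s + x) / s) ltac:(apply Rdiv_lt_0_compat; lra)).
    apply Req_le. field. lra. }
  assert (H2 : (1 - x) * (ln (s + x) - ln s) <= (1 - x) * (x / s)) by (apply Rmult_le_compat_l; lra).
  assert (H3 : (1 - x) * (x / s) <= 1 * / s).
  { replace ((1 - x) * (x / s)) with ((1 - x) * x * / s) by (unfold Rdiv; ring).
    apply Rmult_le_compat_r; [apply Rlt_le, Rinv_0_lt_compat; lra | nra]. }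
  lra.
Qed.

Lemma is_lim_seq_inv_INR_S : is_lim_seq (fun n => / INR (S n)) 0.
Proof.
  apply (is_lim_seq_incr_1 (fun n => / INR n)).
  replace (Finite 0) with (Rbar_inv p_infty) by easy.
  apply is_lim_seq_inv; [apply is_lim_seq_INR | easy].
Qed.

Lemma is_lim_gap_sum x : 0 < x < 1 ->
  is_lim_seq (gap_sum x) (- ln (Gamma (1 + x))).
Proof.
  intros Hx.
  apply is_lim_seq_le_le with (u := fun n => - ln (Gamma (1 + x)) - / INR (S (S n)))
    (w := fun _ => - ln (Gamma (1 + x))).
  - intros n. now apply gap_sum_bounds.
  - replace (Finite (- ln (Gamma (1 + x)))) with (Finite (- ln (Gamma (1 + x)) - 0))
      by (f_equal; ring).
    apply is_lim_seq_minus'; [apply is_lim_seq_const |].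
    apply (is_lim_seq_incr_1 (fun n => / INR (S n))), is_lim_seq_inv_INR_S.
  - apply is_lim_seq_const.
Qed.

(** * Comparison of tail integrals *)

(** This says that [f t] is the integral of [w] from [t] to infinity for [t >= 1], phrased
    through derivatives so that inequalities between integrands transfer to the functions
    without any integral being formed. *)
Definition is_tail (w f : R -> R) : Prop :=
  (forall t, 1 <= t -> is_derive f t (- w t)) /\ is_lim f p_infty 0.

(** The difference [f1 - f2] is nondecreasing on [[a, +oo)] and tends to 0, so it is
    nonpositive at [a]. *)
Lemma is_tail_le (w1 w2 f1 f2 : R -> R) (a : R) :
  1 <= a -> (forall t, a <= t -> w1 t <= w2 t) ->
  is_tail w1 f1 -> is_tail w2 f2 -> f1 a <= f2 a.
Proof.
  intros Ha Hw [Hd1 Hl1] [Hd2 Hl2].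
  assert (H : Rbar_le (f1 a - f2 a) (0 - 0)).
  { apply (filterlim_le (F := Rbar_locally p_infty) (fun _ => f1 a - f2 a)
      (fun t => f1 t - f2 t)).
    - exists a. intros t Ht.
      apply (derive_nonneg_le (fun u => f1 u - f2 u) (fun u => - w1 u - - w2 u)); [lra | |].
      + intros u Hu. apply (is_derive_minus f1 f2); [apply Hd1 | apply Hd2]; lra.
      + intros u Hu. generalize (Hw u). lra.
    - apply filterlim_const.
    - apply (is_lim_minus' f1 f2 p_infty 0 0); assumption. }
  simpl in H. lra.
Qed.

Lemma is_tail_0 : is_tail (fun _ => 0) (fun _ => 0).
Proof.
  split.
  - intros t _. auto_derive; [easy | ring].
  - apply is_lim_const.
Qed.

Lemma is_tail_ext w1 w2 f : (forall t, 1 <= t -> w1 t = w2 t) -> is_tail w1 f -> is_tail w2 f.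
Proof.
  intros H [Hd Hl]. split; [| assumption].
  intros t Ht. rewrite <- H by assumption. now apply Hd.
Qed.

Lemma is_tail_scal k w f : is_tail w f -> is_tail (fun t => k * w t) (fun t => k * f t).
Proof.
  intros [Hd Hl]. split.
  - intros t Ht. replace (- (k * w t)) with (k * - w t) by ring.
    apply (is_derive_scal f), Hd, Ht.
  - replace (Finite 0) with (Rbar_mult k 0) by (simpl; f_equal; ring).
    now apply is_lim_scal_l.
Qed.

Lemma is_tail_minus w1 w2 f1 f2 : is_tail w1 f1 -> is_tail w2 f2 ->
  is_tail (fun t => w1 t - w2 t) (fun t => f1 t - f2 t).
Proof.
  intros [Hd1 Hl1] [Hd2 Hl2]. split.
  - intros t Ht. replace (- (w1 t - w2 t)) with (- w1 t - - w2 t) by ring.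
    apply (is_derive_minus f1 f2); [apply Hd1 | apply Hd2]; assumption.
  - replace (Finite 0) with (Finite (0 - 0)) by (f_equal; ring).
    now apply (is_lim_minus' f1 f2).
Qed.

Lemma is_lim_inv_0 : is_lim (fun t => / t) p_infty 0.
Proof.
  replace (Finite 0) with (Rbar_inv p_infty) by easy.
  apply (is_lim_inv (fun t => t)); [apply is_lim_id | easy].
Qed.

Lemma is_lim_ln_1_plus_div x : 0 <= x -> is_lim (fun t => ln (1 + x / t)) p_infty 0.
Proof.
  intros Hx.
  apply (filterlim_le_le (F := Rbar_locally p_infty) (fun _ => 0) _ (fun t => x * / t) 0).
  - exists 0. intros t Ht.
    assert (H : 0 <= x / t).
    { apply Rmult_le_pos; [assumption |]. now apply Rlt_le, Rinv_0_lt_compat. }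
    split.
    + rewrite <- ln_1. apply ln_le; lra.
    + generalize (ln_le_sub_1 (1 + x / t)). unfold Rdiv in *. lra.
  - apply filterlim_const.
  - replace (Finite 0) with (Rbar_mult x 0) by (simpl; f_equal; ring).
    apply (is_lim_scal_l (fun t => / t) x p_infty 0), is_lim_inv_0.
Qed.

Lemma div_pos_1_plus x t : 0 <= x -> 0 < t -> 0 < 1 + x / t.
Proof.
  intros Hx Ht. assert (0 <= x / t); [| lra].
  apply Rmult_le_pos; [assumption |]. now apply Rlt_le, Rinv_0_lt_compat.
Qed.

Lemma is_tail_ln x : 0 <= x ->
  is_tail (fun t => x / (t * (t + x))) (fun t => ln (1 + x / t)).
Proof.
  intros Hx. split.
  - intros t Ht. assert (H := div_pos_1_plus x t Hx ltac:(lra)).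
    auto_derive.
    + split; [lra | split; [exact H | easy]].
    + field. split; lra.
  - now apply is_lim_ln_1_plus_div.
Qed.

Lemma is_tail_inv : is_tail (fun t => / t ^ 2) (fun t => / t).
Proof.
  split; [| exact is_lim_inv_0].
  intros t Ht. auto_derive; [lra | field; lra].
Qed.

Lemma is_tail_inv_succ : is_tail (fun t => / (t + 1) ^ 2) (fun t => / (t + 1)).
Proof.
  split.
  - intros t Ht. auto_derive; [lra | field; lra].
  - apply (is_lim_ext (fun t => / (1 * t + 1)) _ p_infty 0).
    { intros t. f_equal. ring. }
    apply (is_lim_comp_lin (fun t => / t) 1 1 p_infty 0); [| lra].
    replace (Rbar_plus (Rbar_mult 1 p_infty) 1) with p_infty.
    + apply is_lim_inv_0.
    + simpl. destruct (Rle_dec 0 1); [| exfalso; lra].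
      destruct (Rle_lt_or_eq_dec 0 1 r); [easy | exfalso; lra].
Qed.

Lemma is_tail_inv_sqr : is_tail (fun t => 2 / t ^ 3) (fun t => / t ^ 2).
Proof.
  split.
  - intros t Ht. auto_derive; [intros H; apply (pow_nonzero t 2 ltac:(lra)); simpl; lra | field; lra].
  - apply (is_lim_ext (fun t => / t * / t)).
    { intros t. rewrite <- Rinv_mult. f_equal. ring. }
    replace (Finite 0) with (Rbar_mult 0 0) by (simpl; f_equal; ring).
    apply is_lim_mult; try apply is_lim_inv_0. easy.
Qed.

(** The factor [x * (1 - x)] comes out, and what remains depends on [x] through [/ (t + x)]
    only.  This formula is the source of all the estimates on Gamma below. *)
Lemma is_tail_gap x : 0 <= x ->
  is_tail (fun t => x * (1 - x) / (t * (t + 1) * (t + x))) (gap x).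
Proof.
  intros Hx. eapply is_tail_ext.
  2: { apply is_tail_minus; [apply (is_tail_ln x Hx) |].
       apply is_tail_scal, (is_tail_ln 1 Rle_0_1). }
  intros t Ht. simpl. field. lra.
Qed.

(** The derivative of [gap x t] in [x] at [x = 0].  Its values at the positive integers sum to
    the Euler constant. *)
Definition defect0 (t : R) := / t - ln (1 + 1 / t).

(** The derivative of [gap x t] in [x] at [x = 1], up to sign.  Its values at the positive
    integers sum to 1 minus the Euler constant. *)
Definition defect1 (t : R) := ln (1 + 1 / t) - / (t + 1).

Lemma is_tail_defect0 : is_tail (fun t => / (t ^ 2 * (t + 1))) defect0.
Proof.
  eapply is_tail_ext.
  2: apply is_tail_minus; [apply is_tail_inv | apply (is_tail_ln 1 Rle_0_1)].
  intros t Ht. simpl. field. lra.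
Qed.

Lemma is_tail_defect1 : is_tail (fun t => / (t * (t + 1) ^ 2)) defect1.
Proof.
  eapply is_tail_ext.
  2: apply is_tail_minus; [apply (is_tail_ln 1 Rle_0_1) | apply is_tail_inv_succ].
  intros t Ht. simpl. field. lra.
Qed.

Lemma is_tail_nonneg w f a : 1 <= a -> (forall t, a <= t -> 0 <= w t) -> is_tail w f -> 0 <= f a.
Proof.
  intros Ha Hw Hf. now apply (is_tail_le (fun _ => 0) w (fun _ => 0) f a); try apply is_tail_0.
Qed.

Lemma defect0_nonneg t : 1 <= t -> 0 <= defect0 t.
Proof.
  intros Ht. apply (is_tail_nonneg _ _ t Ht) with (2 := is_tail_defect0).
  intros u Hu. apply Rlt_le, Rinv_0_lt_compat. nra.
Qed.

Lemma defect1_nonneg t : 1 <= t -> 0 <= defect1 t.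
Proof.
  intros Ht. apply (is_tail_nonneg _ _ t Ht) with (2 := is_tail_defect1).
  intros u Hu. apply Rlt_le, Rinv_0_lt_compat. nra.
Qed.

Lemma div_le_div a b c d : 0 < b -> 0 < d -> a * d <= c * b -> a / b <= c / d.
Proof.
  intros Hb Hd H. apply (Rmult_le_reg_r (b * d)); [nra |].
  replace (a / b * (b * d)) with (a * d) by (field; lra).
  replace (c / d * (b * d)) with (c * b) by (field; lra). exact H.
Qed.

(** On the integrands this is [(1 - x) / u <= / (u + x) <= / u] for [u >= 1]. *)
Lemma gap_bounds_0 x t : 0 < x < 1 -> 1 <= t ->
  (1 - x) * (x * (1 - x) * defect0 t) <= gap x t <= x * (1 - x) * defect0 t.
Proof.
  intros Hx Ht. assert (Hp : 0 < x * (1 - x)) by nra. split.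
  - refine (is_tail_le _ _ (fun u => (1 - x) * (x * (1 - x) * defect0 u)) (gap x) t Ht _
      (is_tail_scal _ _ _ (is_tail_scal _ _ _ is_tail_defect0)) (is_tail_gap x _)); [| lra].
    intros u Hu. cbv beta.
    replace ((1 - x) * (x * (1 - x) * / (u ^ 2 * (u + 1)))) with
      ((x * (1 - x) / (u * (u + 1))) * ((1 - x) / u)) by (field; lra).
    replace (x * (1 - x) / (u * (u + 1) * (u + x))) with
      ((x * (1 - x) / (u * (u + 1))) * (1 / (u + x))) by (field; lra).
    apply Rmult_le_compat_l; [apply Rlt_le, Rdiv_lt_0_compat; nra |].
    apply div_le_div; nra.
  - refine (is_tail_le _ _ (gap x) (fun u => x * (1 - x) * defect0 u) t Ht _
      (is_tail_gap x _) (is_tail_scal _ _ _ is_tail_defect0)); [| lra].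
    intros u Hu. cbv beta.
    apply div_le_div; [apply Rmult_lt_0_compat; nra | apply Rmult_lt_0_compat; nra |].
    apply Rmult_le_compat_l; [lra |].
    replace (u ^ 2 * (u + 1)) with (u * (u + 1) * u) by ring.
    apply Rmult_le_compat_l; nra.
Qed.

(** On the integrands this is [/ (u + 1) <= / (u + x) <= (2 - x) / (u + 1)] for [u >= 1]. *)
Lemma gap_bounds_1 x t : 0 < x < 1 -> 1 <= t ->
  x * (1 - x) * defect1 t <= gap x t <= (2 - x) * (x * (1 - x) * defect1 t).
Proof.
  intros Hx Ht. assert (Hp : 0 < x * (1 - x)) by nra. split.
  - refine (is_tail_le _ _ (fun u => x * (1 - x) * defect1 u) (gap x) t Ht _
      (is_tail_scal _ _ _ is_tail_defect1) (is_tail_gap x _)); [| lra].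
    intros u Hu. cbv beta.
    apply div_le_div; [apply Rmult_lt_0_compat; nra | apply Rmult_lt_0_compat; nra |].
    apply Rmult_le_compat_l; [lra |].
    replace (u * (u + 1) ^ 2) with (u * (u + 1) * (u + 1)) by ring.
    apply Rmult_le_compat_l; nra.
  - refine (is_tail_le _ _ (gap x) (fun u => (2 - x) * (x * (1 - x) * defect1 u)) t Ht _
      (is_tail_gap x _) (is_tail_scal _ _ _ (is_tail_scal _ _ _ is_tail_defect1))); [| lra].
    intros u Hu. cbv beta.
    replace ((2 - x) * (x * (1 - x) * / (u * (u + 1) ^ 2))) with
      ((x * (1 - x) / (u * (u + 1))) * ((2 - x) / (u + 1))) by (field; lra).
    replace (x * (1 - x) / (u * (u + 1) * (u + x))) with
      ((x * (1 - x) / (u * (u + 1))) * (1 / (u + x))) by (field; lra).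
    apply Rmult_le_compat_l; [apply Rlt_le, Rdiv_lt_0_compat; nra |].
    apply div_le_div; nra.
Qed.

(** * Growth of the weighted series *)

(** Dividing [gap x t] by [x * (1 - x)] leaves a mixture of the decreasing functions
    [/ (s + x)], [s >= t].  The factor [2 + x] turns them into [(2 + x) / (s + x)], which
    increase for [s > 2] and decrease for [s < 2]. *)
Definition weight (x : R) := (2 + x) / (x * (1 - x)).

(** The derivative at [x = 0] of [weight x * gap x t], extended to 0 by continuity. *)
Definition kappa (t : R) := 3 * defect0 t - / t ^ 2.

Lemma is_tail_kappa : is_tail (fun t => (t - 2) / (t ^ 3 * (t + 1))) kappa.
Proof.
  eapply is_tail_ext.
  2: apply is_tail_minus; [apply is_tail_scal, is_tail_defect0 | apply is_tail_inv_sqr].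
  intros t Ht. simpl. field. lra.
Qed.

Lemma kappa_nonneg t : 2 <= t -> 0 <= kappa t.
Proof.
  intros Ht. apply (is_tail_nonneg _ _ t) with (3 := is_tail_kappa); [lra |].
  intros u Hu. apply Rmult_le_pos; [lra |].
  apply Rlt_le, Rinv_0_lt_compat. apply Rmult_lt_0_compat; [apply pow_lt |]; lra.
Qed.

(** The integrands of both sides change sign at [u = 2] only, and the coefficient of [kappa]
    makes their quotient 1 there.  The quotient increases with [u], so that the difference of
    the integrands has the factor [(u - 2) ^ 2].  Thus the increments between [x] and [y] of all
    terms are controlled by one function of [t]. *)
Lemma weighted_gap_increment x y t : 0 < x -> x < y -> y < 1 -> 1 <= t ->
  4 * (y - x) / ((2 + x) * (2 + y)) * kappa t <= weight y * gap y t - weight x * gap x t.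
Proof.
  intros Hx Hxy Hy Ht.
  set (k := 4 * (y - x) / ((2 + x) * (2 + y))).
  refine (is_tail_le _ _ (fun u => k * kappa u)
    (fun u => weight y * gap y u - weight x * gap x u) t Ht _
    (is_tail_scal _ _ _ is_tail_kappa)
    (is_tail_minus _ _ _ _ (is_tail_scal _ _ _ (is_tail_gap y _))
      (is_tail_scal _ _ _ (is_tail_gap x _)))); try lra.
  intros u Hu. cbv beta.
  assert (0 < u ^ 3) by (apply pow_lt; lra).
  apply Rminus_le_0. unfold weight, k.
  replace (_ - _) with
    ((y - x) * (u - 2) ^ 2 * (2 * u * (x + y) + x * y * (u + 2)) /
      (u ^ 3 * (u + 1) * (u + x) * (u + y) * ((2 + x) * (2 + y)))) by (field; lra).
  assert (Hxy0 : 0 < x * y) by (apply Rmult_lt_0_compat; lra).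
  apply Rdiv_le_0_compat.
  - apply Rmult_le_pos; [apply Rmult_le_pos; [lra | apply pow2_ge_0] | nra].
  - repeat apply Rmult_lt_0_compat; lra.
Qed.

Lemma sum_defect0 n :
  sum_f_R0 (fun k => defect0 (INR (S k))) n =
    sum_f_R0 (fun k => / INR (S k)) n - ln (INR (S (S n))).
Proof.
  induction n as [|n IH].
  - unfold defect0. simpl. f_equal. f_equal. f_equal. field.
  - rewrite !tech5, IH. unfold defect0.
    replace (1 + 1 / INR (S (S n))) with (INR (S (S (S n))) / INR (S (S n))).
    2: { rewrite (S_INR (S (S n))). field. rewrite !S_INR. generalize (pos_INR n). lra. }
    rewrite ln_div by (apply lt_0_INR; lia). ring.
Qed.

(** The logarithms cancel in [defect0 t + defect1 t], and [/ t - / (t + 1)] telescopes. *)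
Lemma sum_defect0_plus_defect1 n :
  sum_f_R0 (fun k => defect0 (INR (S k))) n + sum_f_R0 (fun k => defect1 (INR (S k))) n =
  1 - / INR (S (S n)).
Proof.
  induction n as [|n IH].
  - unfold defect0, defect1. simpl. rewrite Rinv_1. ring.
  - rewrite !tech5.
    replace (1 - / INR (S (S (S n)))) with
      (1 - / INR (S (S n)) + (/ INR (S (S n)) - / INR (S (S (S n))))) by ring.
    rewrite <- IH. unfold defect0 at 2, defect1 at 2.
    rewrite (S_INR (S (S n))). ring.
Qed.

Lemma one_le_INR_S n : 1 <= INR (S n).
Proof. rewrite S_INR. generalize (pos_INR n). lra. Qed.

(** The partial sums increase and are bounded by 1, because [defect1] is nonnegative; so they
    have a finite limit.  They differ from the sequence that defines the Euler constant by
    [ln (1 + 1 / (n + 1))], which tends to 0. *)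
Lemma is_lim_sum_defect0 :
  is_lim_seq (sum_f_R0 (fun k => defect0 (INR (S k)))) euler_gamma.
Proof.
  set (C := sum_f_R0 (fun k => defect0 (INR (S k)))).
  destruct (ex_finite_lim_seq_incr C 1) as [l Hl].
  - intros n. unfold C. rewrite tech5.
    generalize (defect0_nonneg _ (one_le_INR_S (S n))). lra.
  - intros n. generalize (sum_defect0_plus_defect1 n). fold (C n).
    assert (0 <= sum_f_R0 (fun k => defect1 (INR (S k))) n).
    { apply cond_pos_sum. intros k. apply defect1_nonneg, one_le_INR_S. }
    assert (0 < / INR (S (S n))) by (apply Rinv_0_lt_compat, lt_0_INR; lia).
    unfold C. lra.
  - assert (Hg : is_lim_seq (fun n => sum_f_R0 (fun k => / INR (S k)) n - ln (INR (S n))) l).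
    { apply is_lim_seq_ext with (fun n => C n + ln (1 + 1 / INR (S n))).
      - intros n. unfold C. rewrite sum_defect0.
        replace (1 + 1 / INR (S n)) with (INR (S (S n)) / INR (S n)).
        2: { rewrite (S_INR (S n)). field. generalize (one_le_INR_S n). lra. }
        rewrite ln_div by (apply lt_0_INR; lia). ring.
      - replace (Finite l) with (Finite (l + 0)) by (f_equal; ring).
        apply is_lim_seq_plus'; [exact Hl |].
        apply (is_lim_comp_seq (fun t => ln (1 + 1 / t)) (fun n => INR (S n)) p_infty 0).
        + apply is_lim_ln_1_plus_div. lra.
        + now exists 0%nat.
        + apply (is_lim_seq_incr_1 INR), is_lim_seq_INR. }
    unfold euler_gamma. rewrite (is_lim_seq_unique _ _ Hg). exact Hl.
Qed.

Lemma is_lim_sum_defect1 :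
  is_lim_seq (sum_f_R0 (fun k => defect1 (INR (S k)))) (1 - euler_gamma).
Proof.
  apply is_lim_seq_ext with
    (fun n => 1 - / INR (S (S n)) - sum_f_R0 (fun k => defect0 (INR (S k))) n).
  - intros n. rewrite <- sum_defect0_plus_defect1. ring.
  - replace (Finite (1 - euler_gamma)) with (Finite (1 - 0 - euler_gamma)) by (f_equal; ring).
    apply is_lim_seq_minus'; [| exact is_lim_sum_defect0].
    apply is_lim_seq_minus'; [apply is_lim_seq_const |].
    apply (is_lim_seq_incr_1 (fun n => / INR (S n))), is_lim_seq_inv_INR_S.
Qed.

Lemma sum_f_R0_compare (f g : R -> R) k n :
  (forall t, 1 <= t -> f t <= k * g t) ->
  sum_f_R0 (fun i => f (INR (S i))) n <= k * sum_f_R0 (fun i => g (INR (S i))) n.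
Proof.
  intros H. rewrite scal_sum. apply sum_Rle. intros i _.
  rewrite Rmult_comm. apply H, one_le_INR_S.
Qed.

Lemma lim_sum_le (f g : R -> R) k lf lg :
  (forall t, 1 <= t -> f t <= k * g t) ->
  is_lim_seq (sum_f_R0 (fun i => f (INR (S i)))) (Finite lf) ->
  is_lim_seq (sum_f_R0 (fun i => g (INR (S i)))) (Finite lg) ->
  lf <= k * lg.
Proof.
  intros H Hf Hg.
  assert (Hle : Rbar_le lf (Rbar_mult k lg)); [| exact Hle].
  apply (is_lim_seq_le (sum_f_R0 (fun i => f (INR (S i))))
    (fun n => k * sum_f_R0 (fun i => g (INR (S i))) n)); [| exact Hf |].
  - intros n. now apply sum_f_R0_compare.
  - now apply is_lim_seq_scal_l.
Qed.

(** * Bounds for [ln (Gamma (1 + x))] near 0 and near 1 *)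

Lemma ln_Gamma_bounds_0 x : 0 < x < 1 ->
  (1 - x) * (x * (1 - x) * euler_gamma) <= - ln (Gamma (1 + x)) <= x * (1 - x) * euler_gamma.
Proof.
  intros Hx. assert (HG := is_lim_gap_sum x Hx). assert (HD := is_lim_sum_defect0). split.
  - assert (Hp : 0 < (1 - x) * (x * (1 - x))) by (repeat apply Rmult_lt_0_compat; lra).
    assert (H : euler_gamma <= / ((1 - x) * (x * (1 - x))) * - ln (Gamma (1 + x))).
    { apply (lim_sum_le defect0 (gap x)); try assumption.
      intros t Ht. apply (Rmult_le_reg_l _ _ _ Hp).
      replace ((1 - x) * (x * (1 - x)) * (/ ((1 - x) * (x * (1 - x))) * gap x t))
        with (gap x t) by (field; lra).
      generalize (gap_bounds_0 x t Hx Ht). lra. }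
    apply (Rmult_le_compat_l _ _ _ (Rlt_le _ _ Hp)) in H.
    replace ((1 - x) * (x * (1 - x)) * (/ ((1 - x) * (x * (1 - x))) * - ln (Gamma (1 + x))))
      with (- ln (Gamma (1 + x))) in H by (field; lra). lra.
  - apply (lim_sum_le (gap x) defect0); try assumption.
    intros t Ht. now apply gap_bounds_0.
Qed.

Lemma ln_Gamma_bounds_1 x : 0 < x < 1 ->
  x * (1 - x) * (1 - euler_gamma) <= - ln (Gamma (1 + x))
    <= (2 - x) * (x * (1 - x) * (1 - euler_gamma)).
Proof.
  intros Hx. assert (HG := is_lim_gap_sum x Hx). assert (HD := is_lim_sum_defect1). split.
  - assert (Hp : 0 < x * (1 - x)) by (apply Rmult_lt_0_compat; lra).
    assert (H : 1 - euler_gamma <= / (x * (1 - x)) * - ln (Gamma (1 + x))).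
    { apply (lim_sum_le defect1 (gap x)); try assumption.
      intros t Ht. apply (Rmult_le_reg_l _ _ _ Hp).
      replace (x * (1 - x) * (/ (x * (1 - x)) * gap x t))
        with (gap x t) by (field; lra).
      generalize (gap_bounds_1 x t Hx Ht). lra. }
    apply (Rmult_le_compat_l _ _ _ (Rlt_le _ _ Hp)) in H.
    replace (x * (1 - x) * (/ (x * (1 - x)) * - ln (Gamma (1 + x))))
      with (- ln (Gamma (1 + x))) in H by (field; lra). lra.
  - rewrite <- Rmult_assoc.
    apply (lim_sum_le (gap x) defect1); try assumption.
    intros t Ht. rewrite Rmult_assoc. now apply gap_bounds_1.
Qed.

Lemma ln_2_upper : ln 2 <= 0.696.
Proof.
  rewrite <- (ln_exp 0.696). apply ln_le; [lra |].
  apply Rle_trans with (2 := exp_ge_taylor 0.696 5 ltac:(lra)).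
  simpl. lra.
Qed.

(** * Monotonicity of the Gamma factor *)

(** Only the first term is negative, and seven terms are enough to make up for it:
    [3 * (363 / 140 - 3 * ln 2)] exceeds the sum of the first seven inverse
    squares.  Stopping at seven terms makes the logarithm that occurs a multiple of [ln 2]. *)
Lemma sum_kappa_nonneg n : 0 <= sum_f_R0 (fun k => kappa (INR (S k))) (6 + n).
Proof.
  induction n as [|n IH].
  - unfold kappa. rewrite minus_sum.
    rewrite (sum_eq _ (fun k => defect0 (INR (S k)) * 3)) by (intros; ring).
    rewrite <- scal_sum, sum_defect0.
    replace (INR (S (S (6 + 0)))) with (2 * (2 * 2)) by (simpl; ring).
    rewrite !ln_mult by lra. generalize ln_2_upper. simpl. lra.
  - rewrite Nat.add_succ_r, tech5.
    assert (0 <= kappa (INR (S (S (6 + n))))); [| lra].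
    apply kappa_nonneg. rewrite 2!S_INR. generalize (pos_INR (6 + n)). lra.
Qed.

(** Summing the bounds for the increments of the terms, and passing to the limit.  The increment
    of a partial sum of at least seven terms is nonnegative. *)
Lemma weighted_ln_Gamma_incr x y : 0 < x -> x < y -> y < 1 ->
  weight x * - ln (Gamma (1 + x)) <= weight y * - ln (Gamma (1 + y)).
Proof.
  intros Hx Hxy Hy.
  assert (Hle : Rbar_le (Rbar_mult (weight x) (- ln (Gamma (1 + x))))
    (Rbar_mult (weight y) (- ln (Gamma (1 + y))))); [| exact Hle].
  apply (is_lim_seq_le_loc (fun n => weight x * gap_sum x n) (fun n => weight y * gap_sum y n)).
  (* Index 6 is the seventh term, since the sums start from index 0. *)
  - exists 6%nat. intros n Hn. apply Rminus_le_0.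
    unfold gap_sum. rewrite !scal_sum, <- minus_sum.
    replace n with (6 + (n - 6))%nat by lia.
    apply Rle_trans with (4 * (y - x) / ((2 + x) * (2 + y)) *
      sum_f_R0 (fun k => kappa (INR (S k))) (6 + (n - 6))).
    + apply Rmult_le_pos; [| apply sum_kappa_nonneg].
      apply Rdiv_le_0_compat; [lra | apply Rmult_lt_0_compat; lra].
    + rewrite scal_sum. apply sum_Rle. intros i _.
      rewrite Rmult_comm.
      generalize (weighted_gap_increment x y (INR (S i)) Hx Hxy Hy (one_le_INR_S i)). lra.
  - apply is_lim_seq_scal_l, is_lim_gap_sum. lra.
  - apply is_lim_seq_scal_l, is_lim_gap_sum. lra.
Qed.

Lemma euler_gamma_pos : 0 < euler_gamma.
Proof.
  assert (H := is_lim_seq_incr_compare _ _ is_lim_sum_defect0).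
  apply Rlt_le_trans with (2 := H (fun n => ltac:(rewrite tech5;
    generalize (defect0_nonneg _ (one_le_INR_S (S n))); lra)) 0%nat).
  unfold defect0. simpl. replace (1 + 1 / 1) with 2 by field.
  generalize ln_2_upper. lra.
Qed.

Lemma ln_Gamma_neg x : 0 < x < 1 -> 0 < - ln (Gamma (1 + x)).
Proof.
  intros Hx. apply Rlt_le_trans with (2 := proj1 (ln_Gamma_bounds_0 x Hx)).
  repeat apply Rmult_lt_0_compat; try lra. exact euler_gamma_pos.
Qed.

(** * Monotonicity of the elementary factor *)

Definition log_den (x : R) := ln (x + 1) - ln (x ^ 2 + 1).

Definition log_den' (x : R) := (1 - 2 * x - x ^ 2) / ((1 + x) * (1 + x ^ 2)).

Lemma is_derive_log_den x : -1 < x -> is_derive log_den x (log_den' x).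
Proof.
  intros Hx. unfold log_den, log_den'.
  assert (0 < x ^ 2 + 1) by nra.
  auto_derive; [repeat split; simpl in *; lra | field; split; nra].
Qed.

Lemma log_den_pos x : 0 < x < 1 -> 0 < log_den x.
Proof.
  intros Hx. assert (ln (x ^ 2 + 1) < ln (x + 1)); [| unfold log_den; lra].
  apply ln_increasing; nra.
Qed.

Lemma log_den_0 : log_den 0 = 0.
Proof. unfold log_den. replace (0 ^ 2 + 1) with (0 + 1) by ring. ring. Qed.

Lemma log_den_1 : log_den 1 = 0.
Proof. unfold log_den. replace (1 ^ 2 + 1) with (1 + 1) by ring. ring. Qed.

(** With [q x = x * (1 - x) / (2 + x)], this is [q * log_den' / q' - log_den].  Away from the zero
    of [q'], its sign decides that of [q' * log_den - q * log_den']. *)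
Definition critical_gap (x : R) :=
  x * (1 - x) * (2 + x) * (1 - 2 * x - x ^ 2) /
    ((2 - 4 * x - x ^ 2) * ((1 + x) * (1 + x ^ 2))) - log_den x.

(** This is [q * (log_den' / q')'], since the terms [log_den'] cancel. *)
Definition critical_gap' (x : R) :=
  x ^ 2 * (1 - x) *
    (-10 + 10 * x + 31 * x ^ 2 - 40 * x ^ 3 - 40 * x ^ 4 - 10 * x ^ 5 - x ^ 6) /
  ((2 - 4 * x - x ^ 2) * ((1 + x) * (1 + x ^ 2))) ^ 2.

Lemma is_derive_critical_gap x : 0 <= x -> 2 - 4 * x - x ^ 2 <> 0 ->
  is_derive critical_gap x (critical_gap' x).
Proof.
  intros Hx HE.
  assert (H1 : 0 < 1 + x ^ 2) by nra.
  assert (HD : (2 - 4 * x - x ^ 2) * ((1 + x) * (1 + x ^ 2)) <> 0).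
  { repeat apply Rmult_integral_contrapositive_currified; lra. }
  unfold critical_gap.
  set (r := fun x => x * (1 - x) * (2 + x) * (1 - 2 * x - x ^ 2) /
    ((2 - 4 * x - x ^ 2) * ((1 + x) * (1 + x ^ 2)))).
  replace (critical_gap' x) with (critical_gap' x + log_den' x - log_den' x) by ring.
  apply (is_derive_minus r log_den).
  2: apply is_derive_log_den; lra.
  unfold r. auto_derive; [exact HD |].
  unfold critical_gap', log_den'. field. repeat split; lra.
Qed.

Lemma critical_gap'_neg x : 0 < x < 1 -> 2 - 4 * x - x ^ 2 <> 0 -> critical_gap' x < 0.
Proof.
  intros Hx HE.
  assert (H1 : 0 < 1 + x ^ 2) by nra.
  assert (HD : (2 - 4 * x - x ^ 2) * ((1 + x) * (1 + x ^ 2)) <> 0).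
  { repeat apply Rmult_integral_contrapositive_currified; lra. }
  apply Rdiv_neg_pos; [| nra].
  assert (Hp : 0 < x ^ 2 * (1 - x)) by (apply Rmult_lt_0_compat; [apply pow_lt |]; lra).
  assert (0 < x ^ 5) by (apply pow_lt; lra). assert (0 < x ^ 6) by (apply pow_lt; lra).
  assert (10 * x + 31 * x ^ 2 - 40 * x ^ 3 - 40 * x ^ 4 < 10) by nra.
  rewrite <- (Rmult_0_r (x ^ 2 * (1 - x))). apply Rmult_lt_compat_l; lra.
Qed.

Lemma derive_neg_lt (f df : R -> R) (a b : R) : a < b ->
  (forall x, a <= x <= b -> is_derive f x (df x)) ->
  (forall x, a < x < b -> df x < 0) -> f b < f a.
Proof.
  intros Hab Hf Hd.
  destruct (MVT_cor2 f df a b Hab) as [c [Hc1 Hc2]].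
  - intros c Hc. apply is_derive_Reals. now apply Hf.
  - assert (H := Hd c Hc2). nra.
Qed.

(** This is [q' * log_den - q * log_den'], the numerator of the derivative of [q / log_den].  The
    function [critical_gap] decreases and has a pole at the zero [sqrt 6 - 2] of [q'].  On the
    left of the pole it starts from 0 at 0, so it is negative while [q' > 0]; on the right it
    ends with 0 at 1, so it is positive while [q' < 0].  At the pole itself [q' = 0] and
    [log_den' < 0]. *)
Lemma shape_derivative_pos x : 0 < x < 1 ->
  0 < (2 - 4 * x - x ^ 2) / (2 + x) ^ 2 * log_den x - x * (1 - x) / (2 + x) * log_den' x.
Proof.
  intros Hx.
  assert (H1 : 0 < 1 + x ^ 2) by nra.
  assert (Hfac : 2 - 4 * x - x ^ 2 <> 0 ->
    (2 - 4 * x - x ^ 2) / (2 + x) ^ 2 * log_den x - x * (1 - x) / (2 + x) * log_den' x =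
    - critical_gap x * (2 - 4 * x - x ^ 2) / (2 + x) ^ 2).
  { intros HE. unfold critical_gap, log_den'. field. repeat split; lra. }
  assert (H2 : 0 < (2 + x) ^ 2) by (apply pow_lt; lra).
  destruct (Rtotal_order (2 - 4 * x - x ^ 2) 0) as [HE | [HE | HE]].
  - rewrite Hfac by lra.
    apply Rdiv_lt_0_compat; [| exact H2].
    assert (critical_gap 1 < critical_gap x).
    { apply derive_neg_lt with critical_gap'; [lra | |].
      - intros t Ht. apply is_derive_critical_gap; [lra | nra].
      - intros t Ht. apply critical_gap'_neg; [lra | nra]. }
    assert (critical_gap 1 = 0) by (unfold critical_gap; rewrite log_den_1; field).
    nra.
  - rewrite HE. unfold log_den'.
    assert (x < 1 / 2) by nra.
    (* [x ^ 2 = 2 - 4 * x] turns the numerator of [log_den'] into [2 * x - 1]. *)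
    replace (1 - 2 * x - x ^ 2) with (- (1 - 2 * x)) by lra.
    replace (0 / (2 + x) ^ 2 * log_den x - x * (1 - x) / (2 + x) * (- (1 - 2 * x) / ((1 + x) * (1 + x ^ 2))))
      with (x * (1 - x) * (1 - 2 * x) / ((2 + x) * ((1 + x) * (1 + x ^ 2)))) by (field; lra).
    apply Rdiv_lt_0_compat; repeat apply Rmult_lt_0_compat; lra.
  - rewrite Hfac by lra.
    apply Rdiv_lt_0_compat; [| exact H2].
    assert (critical_gap x < critical_gap 0).
    { apply derive_neg_lt with critical_gap'; [lra | |].
      - intros t Ht. apply is_derive_critical_gap; [lra | nra].
      - intros t Ht. apply critical_gap'_neg; [lra | nra]. }
    assert (critical_gap 0 = 0) by (unfold critical_gap; rewrite log_den_0; field).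
    nra.
Qed.

Definition shape (x : R) := x * (1 - x) / (2 + x) / log_den x.

Lemma shape_incr x y : 0 < x -> x < y -> y < 1 -> shape x < shape y.
Proof.
  intros Hx Hxy Hy.
  apply (incr_function shape 0 1 (fun t =>
    ((2 - 4 * t - t ^ 2) / (2 + t) ^ 2 * log_den t - t * (1 - t) / (2 + t) * log_den' t)
      / (log_den t) ^ 2)); simpl; try assumption.
  - intros t Ht0 Ht1. assert (Hp := log_den_pos t (conj Ht0 Ht1)).
    apply (is_derive_div (fun t => t * (1 - t) / (2 + t)) log_den); [| | lra].
    + auto_derive; [lra | field; lra].
    + apply is_derive_log_den. lra.
  - intros t Ht0 Ht1. assert (Hp := log_den_pos t (conj Ht0 Ht1)).
    apply Rdiv_lt_0_compat; [now apply shape_derivative_pos |].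
    rewrite Rmult_1_r. now apply Rmult_lt_0_compat.
Qed.

Lemma shape_pos x : 0 < x < 1 -> 0 < shape x.
Proof.
  intros Hx. unfold shape.
  repeat apply Rdiv_lt_0_compat; [nra | lra | now apply log_den_pos].
Qed.

(** * The ratio: monotonicity and limits *)

Lemma gamma_ratio_eq x : gamma_ratio x = - ln (Gamma (1 + x)) / log_den x.
Proof.
  unfold gamma_ratio, log_den. rewrite (Rplus_comm x 1).
  replace (ln (1 + x) - ln (x ^ 2 + 1)) with (- (ln (x ^ 2 + 1) - ln (1 + x))) by ring.
  unfold Rdiv. rewrite Rinv_opp. ring.
Qed.

Lemma gamma_ratio_factor x : 0 < x < 1 ->
  gamma_ratio x = weight x * - ln (Gamma (1 + x)) * shape x.
Proof.
  intros Hx. assert (Hp := log_den_pos x Hx). rewrite gamma_ratio_eq.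
  unfold weight, shape. field. lra.
Qed.

(** The first factor is nondecreasing only, and strictness comes from the second one. *)
Lemma gamma_ratio_incr x y : 0 < x -> x < y -> y < 1 -> gamma_ratio x < gamma_ratio y.
Proof.
  intros Hx Hxy Hy. rewrite !gamma_ratio_factor by lra.
  assert (Hw := weighted_ln_Gamma_incr x y Hx Hxy Hy).
  assert (Hs := shape_incr x y Hx Hxy Hy).
  assert (Hs0 := shape_pos x ltac:(lra)).
  assert (0 < weight x * - ln (Gamma (1 + x))).
  { apply Rmult_lt_0_compat; [| apply ln_Gamma_neg; lra].
    apply Rdiv_lt_0_compat; nra. }
  nra.
Qed.

(** Near each end of [(0, 1)] the ratio lies between two multiples of this function, whose
    factors tend to the same constant. *)
Definition profile (x : R) := x * (1 - x) / log_den x.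

(** This replaces l'Hopital's rule at the two zeros 0 and 1 of [log_den]. *)
Lemma is_lim_slope (f : R -> R) (a l : R) :
  f a = 0 -> is_derive f a l -> is_lim (fun x => f x / (x - a)) a l.
Proof.
  intros Ha Hf. apply is_derive_Reals in Hf.
  apply filterlim_locally. intros eps.
  destruct (Hf eps (cond_pos eps)) as [d Hd].
  exists d. intros y Hy Hya.
  assert (H := Hd (y - a)).
  rewrite Rplus_minus, Ha, Rminus_0_r in H.
  apply H; [| exact Hy]. intros Hya'. apply Hya, Rminus_diag_uniq, Hya'.
Qed.

Lemma is_lim_profile_0 : is_lim profile 0 1.
Proof.
  assert (H : is_lim (fun x => log_den x / (x - 0)) 0 1).
  { apply is_lim_slope; [apply log_den_0 |].
    replace 1 with (log_den' 0) by (unfold log_den'; field).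
    apply is_derive_log_den. lra. }
  assert (Hn : is_lim (fun x => 1 - x) 0 (1 - 0)).
  { apply (is_lim_minus' (fun _ => 1) (fun x => x)); [apply is_lim_const | apply is_lim_id]. }
  rewrite Rminus_0_r in Hn.
  apply (is_lim_ext_loc (fun x => (1 - x) / (log_den x / (x - 0)))).
  - exists (mkposreal 1 Rlt_0_1). intros x Hx Hx0. unfold profile.
    apply Rabs_lt_between' in Hx. simpl in Hx.
    destruct (Req_dec (log_den x) 0) as [E | E].
    + rewrite E. unfold Rdiv. rewrite !Rmult_0_l, Rinv_0. ring.
    + field. repeat split; first [exact E | exact Hx0 | lra].
  - replace (Finite 1) with (Rbar_div 1 1) by (simpl; f_equal; field).
    apply is_lim_div; try assumption; [| easy].
    intros E. injection E. lra.
Qed.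

Lemma is_lim_profile_1 : is_lim profile 1 2.
Proof.
  assert (H : is_lim (fun x => log_den x / (x - 1)) 1 (- / 2)).
  { apply is_lim_slope; [apply log_den_1 |].
    replace (- / 2) with (log_den' 1) by (unfold log_den'; field).
    apply is_derive_log_den. lra. }
  assert (Hn : is_lim (fun x => - x) 1 (-1)).
  { apply (is_lim_opp (fun x => x) 1 1), is_lim_id. }
  apply (is_lim_ext_loc (fun x => - x / (log_den x / (x - 1)))).
  - exists (mkposreal 1 Rlt_0_1). intros x Hx Hx0. unfold profile.
    apply Rabs_lt_between' in Hx. simpl in Hx.
    destruct (Req_dec (log_den x) 0) as [E | E].
    + rewrite E. unfold Rdiv. rewrite !Rmult_0_l, Rinv_0. ring.
    + field. repeat split; first [exact E | exact Hx0 | lra].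
  - replace (Finite 2) with (Rbar_div (-1) (- / 2)) by (simpl; f_equal; field).
    apply is_lim_div; try assumption; [| easy].
    intros E. injection E. lra.
Qed.

Lemma gamma_ratio_bounds_0 x : 0 < x < 1 ->
  (1 - x) * (profile x * euler_gamma) <= gamma_ratio x <= profile x * euler_gamma.
Proof.
  intros Hx. assert (Hp := Rinv_0_lt_compat _ (log_den_pos x Hx)).
  assert (H := ln_Gamma_bounds_0 x Hx).
  rewrite gamma_ratio_eq. unfold profile, Rdiv.
  split; [apply Rle_trans with ((1 - x) * (x * (1 - x) * euler_gamma) * / log_den x)
         | apply Rle_trans with (x * (1 - x) * euler_gamma * / log_den x)];
    solve [apply Req_le; ring | apply Rmult_le_compat_r; lra].
Qed.

Lemma gamma_ratio_bounds_1 x : 0 < x < 1 ->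
  profile x * (1 - euler_gamma) <= gamma_ratio x <= (2 - x) * (profile x * (1 - euler_gamma)).
Proof.
  intros Hx. assert (Hp := Rinv_0_lt_compat _ (log_den_pos x Hx)).
  assert (H := ln_Gamma_bounds_1 x Hx).
  rewrite gamma_ratio_eq. unfold profile, Rdiv.
  split; [apply Rle_trans with (x * (1 - x) * (1 - euler_gamma) * / log_den x)
         | apply Rle_trans with ((2 - x) * (x * (1 - x) * (1 - euler_gamma)) * / log_den x)];
    solve [apply Req_le; ring | apply Rmult_le_compat_r; lra].
Qed.

Lemma is_lim_mult_R (f g : R -> R) (a lf lg : R) :
  is_lim f a lf -> is_lim g a lg -> is_lim (fun x => f x * g x) a (lf * lg).
Proof. intros Hf Hg. now apply (is_lim_mult f g a lf lg). Qed.

Lemma at_right_locally' (a : R) : filter_le (at_right a) (locally' a).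
Proof.
  intros P [d Hd]. exists d. intros y Hy Hay. apply Hd; [exact Hy | lra].
Qed.

Lemma at_left_locally' (a : R) : filter_le (at_left a) (locally' a).
Proof.
  intros P [d Hd]. exists d. intros y Hy Hay. apply Hd; [exact Hy | lra].
Qed.

Lemma filterlim_gamma_ratio_0 : filterlim gamma_ratio (at_right 0) (locally euler_gamma).
Proof.
  assert (Hu : is_lim (fun x => profile x * euler_gamma) 0 (1 * euler_gamma)).
  { apply is_lim_mult_R; [exact is_lim_profile_0 | apply is_lim_const]. }
  assert (Hl : is_lim (fun x => (1 - x) * (profile x * euler_gamma)) 0
    ((1 - 0) * (1 * euler_gamma))).
  { apply is_lim_mult_R; [| exact Hu].
    apply (is_lim_minus' (fun _ => 1) (fun x => x)); [apply is_lim_const | apply is_lim_id]. }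
  replace (1 * euler_gamma) with euler_gamma in Hu by ring.
  replace ((1 - 0) * (1 * euler_gamma)) with euler_gamma in Hl by ring.
  apply (filterlim_le_le (fun x => (1 - x) * (profile x * euler_gamma)) _
    (fun x => profile x * euler_gamma) euler_gamma).
  - exists (mkposreal 1 Rlt_0_1). intros x Hx Hx0.
    apply Rabs_lt_between' in Hx. simpl in Hx. apply gamma_ratio_bounds_0. lra.
  - eapply filterlim_filter_le_1; [apply at_right_locally' | exact Hl].
  - eapply filterlim_filter_le_1; [apply at_right_locally' | exact Hu].
Qed.

Lemma filterlim_gamma_ratio_1 :
  filterlim gamma_ratio (at_left 1) (locally (2 * (1 - euler_gamma))).
Proof.
  assert (Hl : is_lim (fun x => profile x * (1 - euler_gamma)) 1 (2 * (1 - euler_gamma))).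
  { apply is_lim_mult_R; [exact is_lim_profile_1 | apply is_lim_const]. }
  assert (Hu : is_lim (fun x => (2 - x) * (profile x * (1 - euler_gamma))) 1
    ((2 - 1) * (2 * (1 - euler_gamma)))).
  { apply is_lim_mult_R; [| exact Hl].
    apply (is_lim_minus' (fun _ => 2) (fun x => x)); [apply is_lim_const | apply is_lim_id]. }
  replace ((2 - 1) * (2 * (1 - euler_gamma))) with (2 * (1 - euler_gamma)) in Hu by ring.
  apply (filterlim_le_le (fun x => profile x * (1 - euler_gamma)) _
    (fun x => (2 - x) * (profile x * (1 - euler_gamma))) (2 * (1 - euler_gamma))).
  - exists (mkposreal 1 Rlt_0_1). intros x Hx Hx0.
    apply Rabs_lt_between' in Hx. simpl in Hx. apply gamma_ratio_bounds_1. lra.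
  - eapply filterlim_filter_le_1; [apply at_left_locally' | exact Hl].
  - eapply filterlim_filter_le_1; [apply at_left_locally' | exact Hu].
Qed.

(** * The double inequalities *)

(** An increasing function stays strictly below its limit at the right end, which is therefore
    its least upper bound and is not attained. *)
Lemma gamma_ratio_lt_iff alpha :
  (forall x, 0 < x < 1 -> gamma_ratio x < alpha) <-> alpha >= 2 * (1 - euler_gamma).
Proof.
  split.
  - intros H. apply Rle_ge.
    assert (Hle : Rbar_le (2 * (1 - euler_gamma)) alpha); [| exact Hle].
    apply (filterlim_le (F := at_left 1) gamma_ratio (fun _ => alpha)).
    + exists (mkposreal 1 Rlt_0_1). intros x Hx Hx0.
      apply Rabs_lt_between' in Hx. simpl in Hx. apply Rlt_le, H. lra.
    + exact filterlim_gamma_ratio_1.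
    + apply filterlim_const.
  - intros Ha x Hx.
    apply Rlt_le_trans with (gamma_ratio ((x + 1) / 2)); [apply gamma_ratio_incr; lra |].
    apply Rle_trans with (2 := Rge_le _ _ Ha).
    assert (Hle : Rbar_le (gamma_ratio ((x + 1) / 2)) (2 * (1 - euler_gamma))); [| exact Hle].
    apply (filterlim_le (F := at_left 1) (fun _ => gamma_ratio ((x + 1) / 2)) gamma_ratio).
    + assert (Hd : 0 < (1 - x) / 2) by lra.
      exists (mkposreal _ Hd). intros y Hy Hy1.
      apply Rabs_lt_between' in Hy. simpl in Hy. apply Rlt_le, gamma_ratio_incr; lra.
    + apply filterlim_const.
    + exact filterlim_gamma_ratio_1.
Qed.

Lemma lt_gamma_ratio_iff beta :
  (forall x, 0 < x < 1 -> beta < gamma_ratio x) <-> beta <= euler_gamma.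
Proof.
  split.
  - intros H.
    assert (Hle : Rbar_le beta euler_gamma); [| exact Hle].
    apply (filterlim_le (F := at_right 0) (fun _ => beta) gamma_ratio).
    + exists (mkposreal 1 Rlt_0_1). intros x Hx Hx0.
      apply Rabs_lt_between' in Hx. simpl in Hx. apply Rlt_le, H. lra.
    + apply filterlim_const.
    + exact filterlim_gamma_ratio_0.
  - intros Hb x Hx.
    apply Rle_lt_trans with (gamma_ratio (x / 2)); [| apply gamma_ratio_incr; lra].
    apply Rle_trans with (1 := Hb).
    assert (Hle : Rbar_le euler_gamma (gamma_ratio (x / 2))); [| exact Hle].
    apply (filterlim_le (F := at_right 0) gamma_ratio (fun _ => gamma_ratio (x / 2))).
    + assert (Hd : 0 < x / 2) by lra.
      exists (mkposreal _ Hd). intros y Hy Hy1.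
      apply Rabs_lt_between' in Hy. simpl in Hy. apply Rlt_le, gamma_ratio_incr; lra.
    + exact filterlim_gamma_ratio_0.
    + apply filterlim_const.
Qed.

(** The ratio is the logarithm of [Gamma (x + 1)] to the base [(x ^ 2 + 1) / (x + 1)]; as this
    base is less than 1, the inequalities between exponents are reversed. *)
Lemma Gamma_eq_Rpower x : 0 < x < 1 ->
  Gamma (x + 1) = Rpower ((x ^ 2 + 1) / (x + 1)) (gamma_ratio x).
Proof.
  intros Hx. assert (Hp := log_den_pos x Hx).
  unfold Rpower. rewrite ln_div by nra.
  replace (ln (x ^ 2 + 1) - ln (x + 1)) with (- log_den x) by (unfold log_den; ring).
  rewrite gamma_ratio_eq.
  replace (- ln (Gamma (1 + x)) / log_den x * - log_den x) with (ln (Gamma (1 + x)))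
    by (field; lra).
  rewrite exp_ln by now apply Gamma_1_2_pos. f_equal. ring.
Qed.

Lemma Rpower_base_lt_iff x a b : 0 < x < 1 ->
  Rpower ((x ^ 2 + 1) / (x + 1)) a < Rpower ((x ^ 2 + 1) / (x + 1)) b <-> b < a.
Proof.
  intros Hx. assert (Hp := log_den_pos x Hx).
  unfold Rpower. rewrite ln_div by nra.
  replace (ln (x ^ 2 + 1) - ln (x + 1)) with (- log_den x) by (unfold log_den; ring).
  split; intros H.
  - apply exp_lt_inv in H. nra.
  - apply exp_increasing. nra.
Qed.

Lemma Gamma_double_inequality alpha beta :
  (forall x, 0 < x < 1 ->
     Rpower ((x ^ 2 + 1) / (x + 1)) alpha < Gamma (x + 1) /\
     Gamma (x + 1) < Rpower ((x ^ 2 + 1) / (x + 1)) beta)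
  <-> (alpha >= 2 * (1 - euler_gamma) /\ beta <= euler_gamma).
Proof.
  rewrite <- gamma_ratio_lt_iff, <- lt_gamma_ratio_iff.
  split.
  - intros H. split; intros x Hx; destruct (H x Hx) as [Ha Hb];
      rewrite Gamma_eq_Rpower in Ha, Hb by assumption;
      now apply (Rpower_base_lt_iff x).
  - intros [Ha Hb] x Hx. rewrite Gamma_eq_Rpower by assumption.
    split; apply Rpower_base_lt_iff; auto.
Qed.

Lemma Gamma_falling_product n r : 0 < r ->
  let prod := fold_right Rmult 1 (map (fun i => INR n + r - INR i) (seq 0 n)) in
  0 < prod /\ Gamma (INR n + r + 1) = prod * Gamma (r + 1).
Proof.
  intros Hr. cbv zeta. induction n as [|n [IHp IHg]].
  - simpl. rewrite Rplus_0_l. split; [lra | ring].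
  - assert (Hn := pos_INR n). cbn [seq map fold_right].
    assert (E : map (fun i => INR (S n) + r - INR i) (seq 1 n)
              = map (fun i => INR n + r - INR i) (seq 0 n)).
    { rewrite <- seq_shift, map_map. apply map_ext. intros i. rewrite !S_INR. ring. }
    rewrite E. change (INR 0) with 0. rewrite Rminus_0_r. split.
    + apply Rmult_lt_0_compat; [rewrite S_INR; lra | exact IHp].
    + replace (INR (S n) + r) with (INR n + r + 1) by (rewrite S_INR; ring).
      rewrite Gamma_succ by lra. rewrite IHg. ring.
Qed.

Lemma Int_part_unit x : 0 < x < 1 -> Int_part x = 0%Z.
Proof. intros Hx. symmetry. apply Int_part_spec. lra. Qed.

Lemma floor_decomposition x : 0 < x -> ~ (exists n : nat, (1 <= n)%nat /\ x = INR n) ->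
  let r := x - IZR (Int_part x) in
  0 < r < 1 /\ 0 < floor_prod x /\ Gamma (x + 1) = floor_prod x * Gamma (r + 1).
Proof.
  intros Hx Hn r. destruct (base_Int_part x) as [H1 H2].
  assert (Hz : (0 <= Int_part x)%Z).
  { assert (H : (-1 < Int_part x)%Z) by (apply lt_IZR; lra). lia. }
  set (n := Z.to_nat (Int_part x)).
  assert (En : IZR (Int_part x) = INR n).
  { unfold n. rewrite INR_IZR_INZ, Z2Nat.id; easy. }
  assert (Hr : 0 < r < 1).
  { split; [| unfold r; lra]. destruct (Rle_lt_or_eq_dec 0 r) as [h|h]; [unfold r; lra | easy |].
    exfalso. apply Hn. exists n. split; [| unfold r in h; lra].
    destruct n; [| lia]. simpl in En. unfold r in h. lra. }
  split; [exact Hr |].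
  assert (Ex : x = INR n + r) by (unfold r; lra).
  destruct (Gamma_falling_product n r (proj1 Hr)) as [Hp Hg].
  rewrite <- Ex in Hp, Hg. split; assumption.
Qed.

Theorem theorem1 :
  (forall x y : R, 0 < x -> x < y -> y < 1 -> gamma_ratio x < gamma_ratio y)
  /\ filterlim gamma_ratio (at_right 0) (locally euler_gamma)
  /\ filterlim gamma_ratio (at_left 1) (locally (2 * (1 - euler_gamma)))
  /\ (forall alpha beta : R,
        (forall x : R, 0 < x < 1 ->
           Rpower ((x ^ 2 + 1) / (x + 1)) alpha < Gamma (x + 1)
           /\ Gamma (x + 1) < Rpower ((x ^ 2 + 1) / (x + 1)) beta)
        <-> (alpha >= 2 * (1 - euler_gamma) /\ beta <= euler_gamma))
  /\ (forall alpha beta : R,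
        (forall x : R, 0 < x ->
           ~ (exists n : nat, (1 <= n)%nat /\ x = INR n) ->
           Rpower (((x - IZR (Int_part x)) ^ 2 + 1) / (x - IZR (Int_part x) + 1)) alpha
             * floor_prod x < Gamma (x + 1)
           /\ Gamma (x + 1) <
              Rpower (((x - IZR (Int_part x)) ^ 2 + 1) / (x - IZR (Int_part x) + 1)) beta
                * floor_prod x)
        <-> (alpha >= 2 * (1 - euler_gamma) /\ beta <= euler_gamma)).
Proof.
  repeat match goal with |- _ /\ _ => split | |- forall _ _ : R, _ <-> _ => intros alpha beta end.
  - exact gamma_ratio_incr.
  - exact filterlim_gamma_ratio_0.
  - exact filterlim_gamma_ratio_1.
  - apply Gamma_double_inequality.
  - rewrite <- Gamma_double_inequality. split.
    + intros H x Hx. specialize (H x (proj1 Hx)).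
      assert (E := Int_part_unit x Hx).
      unfold floor_prod in H. rewrite E in H. simpl Z.to_nat in H. cbn [seq map fold_right] in H.
      rewrite !Rmult_1_r, Rminus_0_r in H. apply H.
      intros [n [Hn ->]]. apply le_INR in Hn. simpl in Hn. lra.
    + intros H x Hx Hn.
      destruct (floor_decomposition x Hx Hn) as [Hr [Hp ->]].
      destruct (H _ Hr) as [Ha Hb].
      rewrite (Rmult_comm (floor_prod x)).
      split; now apply Rmult_lt_compat_r.
Qed.
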